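(* Let $t\ge1$, $G=\mathbb{Z}_{4t+2}$, and let $\psi:G\times G\to\{\pm1\}$ be a normalized cocycle that is not a coboundary. Index the rows and columns of $M_\psi=[\psi(g,h)]$ by $1,\ldots,4t+2$, corresponding to the elements $0,1,\ldots,4t+1$. Then: (i) for $2\le i\le 4t+2$, the $i$th row sum of $M_\psi$ equals, up to sign, its $(4t+4-i)$th row sum; (ii) the $(2t+2)$th row sum of $M_\psi$ is $0$; (iii) $\psi$ is quasi-orthogonal if and only if the $i$th row sum of $M_\psi$ is $0$ for every even $i$ and $\pm2$ for every odd $i>1$.
   Context: A normalized cocycle satisfies $\psi(0,0)=1$ and $\psi(g,h)\psi(g+h,k)=\psi(g,h+k)\psi(h,k)$; a coboundary is one of the form $\partial\varphi(g,h)=\varphi(g)\varphi(h)\varphi(g+h)$ with $\varphi(0)=1$. Every non-coboundary over $\mathbb Z_{4t+2}$ has the form $\gamma\,\partial_{i_1}\cdots\partial_{i_w}$, where $\gamma(j,k)=(-1)^{\lfloor (j+k)/(4t+2)\rfloor}$ and $\partial_i=\partial\delta_i$, $\delta_i$ being $-1$ at the element $i-1$ and $1$ elsewhere. Row excess $RE(M_\psi)=\sum_{g\ne0}|\sum_h\psi(g,h)|$; a non-coboundary $\psi$ is quasi-orthogonal iff $RE(M_\psi)=4t$. *)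

(* Defs.v *)
From HB Require Import structures.
From mathcomp Require Import all_boot all_order all_algebra.
Set Implicit Arguments.
Unset Strict Implicit.
Unset Printing Implicit Defensive.
Import Order.TTheory GRing.Theory Num.Theory.
Local Open Scope ring_scope.

Definition pm1 (x : int) : Prop := x = 1 \/ x = -1.

Definition normalized_cocycle (G : zmodType) (psi : G -> G -> int) : Prop :=
  [/\ forall g h, pm1 (psi g h),
      psi 0 0 = 1
    & forall g h k, psi g h * psi (g + h) k = psi g (h + k) * psi h k].

(* phi (g + h) stands for its inverse, since phi takes values in {1, -1}. *)
Definition cobound (G : zmodType) (phi : G -> int) (g h : G) : int :=
  phi g * phi h * phi (g + h).

Definition coboundary (G : zmodType) (psi : G -> G -> int) : Prop :=
  exists phi : G -> int,
    [/\ forall g, pm1 (phi g),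
        phi 0 = 1
      & forall g h, psi g h = cobound phi g h].

(* 'Z_n is by definition the ordinal type 'I_(Zp_trunc n).+2, so it indexes
   the rows and columns directly. *)
Definition cocycle_mx (n : nat) (psi : 'Z_n -> 'Z_n -> int) :
    'M[int]_((Zp_trunc n).+2) :=
  \matrix_(g, h) psi g h.

Definition row_sum (m n : nat) (M : 'M[int]_(m, n)) (g : 'I_m) : int :=
  \sum_h M g h.

(* Rows numbered from 1: the i-th row is that of the group element i - 1. *)
Definition nth_row_sum (n : nat) (psi : 'Z_n -> 'Z_n -> int) (i : nat) : int :=
  row_sum (cocycle_mx psi) (i.-1%:R : 'Z_n).

Definition row_excess (m n : nat) (M : 'M[int]_(m.+1, n)) : int :=
  \sum_(g | g != ord0) `|row_sum M g|.

(* The notion for cocycles that are not coboundaries. *)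
Definition quasi_orthogonal (t : nat)
    (psi : 'Z_(4 * t + 2) -> 'Z_(4 * t + 2) -> int) : Prop :=
  ~ coboundary psi /\ row_excess (cocycle_mx psi) = (4 * t)%N%:Z.

(* Main.v *)
Require Import Defs.
From HB Require Import structures.
From mathcomp Require Import all_boot all_order all_algebra.
From mathcomp Require Import zify ring.
Set Implicit Arguments.
Unset Strict Implicit.
Unset Printing Implicit Defensive.
Import Order.TTheory GRing.Theory Num.Theory.
Local Open Scope ring_scope.

(** Write R(g) for the sum of row g.  The cocycle identity at (g, -g, k) gives
    R(-g) = psi(g,-g) R(g), which is (i).  On naturals, psi(j,k) =
    phi(j) phi(k) phi(j+k) with phi(j) = prod_(i<j) psi(1,i), and
    phi(j+n) = phi(j) phi(n) for n = 4t+2; so psi is a coboundary unless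
    phi(n) = -1.  Then psi(m,m) = phi(2m) = -1 for m = 2t+1, whence
    R(m) = -R(m), which is (ii).  Multiplying the cocycle identity over k shows
    that g |-> prod_k psi(g,k) is a morphism (n is even), so it is 1 at every
    even g; the row of such a g has an even number of entries -1, thus
    R(g) = n = 2 modulo 4 and |R(g)| >= 2.  There are 2t even g <> 0, so the row
    excess is at least 4t, with equality exactly in the situation of (iii). *)

Lemma pm1_sqr (x : int) : pm1 x -> x * x = 1.
Proof. by case=> ->. Qed.

Lemma pm1M (x y : int) : pm1 x -> pm1 y -> pm1 (x * y).
Proof. by case=> ->; case=> ->; [left|right|right|left]. Qed.

Lemma pm1_prod (I : Type) (r : seq I) (f : I -> int) :
  (forall i, pm1 (f i)) -> pm1 (\prod_(i <- r) f i).
Proof. by move=> hf; apply: big_ind => //; [left | exact: pm1M]. Qed.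

(** Each entry -1 lowers the sum by 2 from the length and flips the product, so the product
    determines the sum modulo 4. *)
Lemma sum_pm1_mod4 (I : Type) (r : seq I) (f : I -> int) :
  (forall i, pm1 (f i)) ->
  exists z : int,
    \sum_(i <- r) f i = (size r)%:Z + (\prod_(i <- r) f i - 1) + 4 * z.
Proof.
move=> hf; elim: r => [|x r [z IH]]; first by exists 0; rewrite !big_nil.
rewrite !big_cons IH /=.
have [->|->] := hf x; first by exists z; lia.
by case: (pm1_prod r hf) => ->; [exists z | exists (z - 1)]; lia.
Qed.

Section FiniteGroupCocycle.

Variables (G : finZmodType) (psi : G -> G -> int).
Hypothesis hpsi : normalized_cocycle psi.

Let psi_pm1 g h : pm1 (psi g h). Proof. by case: hpsi. Qed.
Let psi_sqr g h : psi g h * psi g h = 1. Proof. exact: pm1_sqr. Qed.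

Let psiA g h k : psi g h * psi (g + h) k = psi g (h + k) * psi h k.
Proof. by case: hpsi. Qed.

Lemma cocycle0l k : psi 0 k = 1.
Proof.
have := psiA 0 0 k; rewrite !add0r; case: hpsi => _ -> _.
by rewrite psi_sqr mul1r.
Qed.

Lemma cocycle0r g : psi g 0 = 1.
Proof.
have := psiA g 0 0; rewrite !addr0; case: hpsi => _ -> _.
by rewrite psi_sqr mulr1.
Qed.

Lemma cocycleN g k : psi (- g) k = psi g (- g) * psi g (k - g).
Proof.
have := psiA g (- g) k; rewrite subrr cocycle0l mulr1 [- g + k]addrC => ->.
by rewrite mulrAC psi_sqr mul1r.
Qed.

Lemma cocycle_sumN g : \sum_h psi (- g) h = psi g (- g) * \sum_h psi g h.
Proof.
rewrite mulr_sumr [RHS](reindex_inj (addIr (- g))) /=.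
by apply: eq_bigr => h _; apply: cocycleN.
Qed.

(** In the cocycle identity multiplied over k, the constant factor contributes [psi g h ^+ #|G|],
    which is 1 for even order; translation by h does not change the product of row g. *)
Lemma cocycle_prodD g h : ~~ odd #|G| ->
  \prod_k psi (g + h) k = \prod_k psi g k * \prod_k psi h k.
Proof.
move=> G_even.
have : \prod_k (psi g h * psi (g + h) k) = \prod_k (psi g (h + k) * psi h k).
  by apply: eq_bigr.
rewrite !big_split /= prodr_const.
have -> : psi g h ^+ #|G| = 1.
  by rewrite -(even_halfK G_even) -mul2n exprM expr2 psi_sqr expr1n.
rewrite mul1r => ->; congr (_ * _).
by rewrite [RHS](reindex_inj (addrI h)).
Qed.

Lemma cocycle_prod_double g : ~~ odd #|G| -> \prod_k psi (g + g) k = 1.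
Proof.
by move=> G_even; rewrite cocycle_prodD //; apply: pm1_sqr; apply: pm1_prod.
Qed.

Lemma cocycle_sum_double_ge2 g t : #|G| = (4 * t + 2)%N ->
  2 <= `|\sum_k psi (g + g) k|.
Proof.
move=> cardG.
have [z ->] := sum_pm1_mod4 (index_enum G) (psi_pm1 (g + g)).
rewrite cocycle_prod_double; last by rewrite cardG; lia.
(* The sum is now 4t + 2 + 4z, which cannot be 0 or ±1. *)
by rewrite -[index_enum G]enumT -cardE cardG; lia.
Qed.

Section Potential.

Variable e : G.

(** The argument is a natural number, not a multiple of e: the failure of periodicity is precisely
    what detects a non-coboundary. *)
Definition potential (j : nat) : int := \prod_(i < j) psi e (e *+ i).

Lemma potential_pm1 j : pm1 (potential j).
Proof. by apply: pm1_prod. Qed.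

Lemma potentialS j : potential j.+1 = potential j * psi e (e *+ j).
Proof. exact: big_ord_recr. Qed.

Lemma cocycle_potential j k :
  psi (e *+ j) (e *+ k) = potential j * potential k * potential (j + k).
Proof.
elim: j => [|j IH].
  by rewrite mulr0n cocycle0l {1}/potential big_ord0 mul1r add0n
             (pm1_sqr (potential_pm1 k)).
have := psiA e (e *+ j) (e *+ k).
(* Values ±1 are their own inverses, so multiplying by [psi e (e *+ j)] isolates
   [psi (e *+ j.+1) (e *+ k)]. *)
rewrite -mulrS -mulrnDr IH => /(congr1 ( *%R (psi e (e *+ j)))).
rewrite mulrA psi_sqr mul1r => ->.
by rewrite addSn !potentialS; ring.
Qed.

Lemma potential_period n j : e *+ n = 0 ->
  potential (j + n) = potential j * potential n.
Proof.
move=> en0; have := cocycle_potential j n; rewrite en0 cocycle0r.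
move/(congr1 ( *%R^~ (potential (j + n)))).
by rewrite mul1r -mulrA (pm1_sqr (potential_pm1 _)) mulr1.
Qed.

End Potential.

End FiniteGroupCocycle.

Arguments potential {G} psi e j.

Section CyclicCocycle.

Variables (n : nat) (psi : 'Z_n -> 'Z_n -> int).
Hypotheses (n_gt1 : (1 < n)%N) (hpsi : normalized_cocycle psi).

(** With value 1 at n, the potential would be n-periodic, hence descend to ['Z_n] and exhibit psi as
    a coboundary. *)
Lemma potential_noncoboundary : ~ coboundary psi -> potential psi 1 n = -1.
Proof.
move=> hnc; case: (potential_pm1 hpsi 1 n) => // c1; case: hnc.
have per j : potential psi 1 j = potential psi 1 (j %% n)%N.
  rewrite {1}(divn_eq j n) addnC; elim: (_ %/ _)%N => [|q IH].
    by rewrite mul0n addn0.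
  rewrite mulSnr addnA (potential_period hpsi) ?IH ?c1 ?mulr1 //.
  exact: pchar_Zp.
exists (fun g : 'Z_n => potential psi 1 g); split=> [g||g h].
- exact: potential_pm1.
- by rewrite /potential big_ord0.
- rewrite -{1}[g]natr_Zp -{1}[h]natr_Zp (cocycle_potential hpsi).
  rewrite (per (g + h)%N) /cobound /=; congr (_ * potential psi 1 _).
  by rewrite [X in _ = (_ %% X)%N]Zp_cast.
Qed.

Lemma noncoboundary_half m : ~ coboundary psi -> n = (m + m)%N ->
  psi m%:R m%:R = -1.
Proof.
move=> hnc nE; rewrite (cocycle_potential hpsi) -nE potential_noncoboundary //.
by rewrite (pm1_sqr (potential_pm1 hpsi _ _)).
Qed.

Lemma nth_row_sumE i : nth_row_sum psi i = \sum_h psi i.-1%:R h.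
Proof. by apply: eq_bigr => h _; rewrite mxE. Qed.

End CyclicCocycle.

Lemma sum_even_lt t :
  (\sum_(0 <= i < 4 * t + 2 | i != 0) (if odd i then 0 else 2) = 4 * t)%N.
Proof.
elim: t => [|t IH]; first by rewrite unlock.
(* Four further indices contain two even ones, adding 4. *)
have -> : (4 * t.+1 + 2 = (4 * t + 2).+4)%N by lia.
rewrite big_mkcond /= !big_nat_recr //= -big_mkcond IH /=.
have -> : odd (4 * t + 2) = false by lia.
by rewrite addn2 /=; lia.
Qed.

Theorem lemma5 (t : nat) (ht : (1 <= t)%N)
    (psi : 'Z_(4 * t + 2) -> 'Z_(4 * t + 2) -> int)
    (hpsi : normalized_cocycle psi) (hnc : ~ coboundary psi) :
  [/\ forall i : nat, (2 <= i <= 4 * t + 2)%N ->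
        nth_row_sum psi i = nth_row_sum psi (4 * t + 4 - i)%N \/
        nth_row_sum psi i = - nth_row_sum psi (4 * t + 4 - i)%N,
      nth_row_sum psi (2 * t + 2)%N = 0
    & quasi_orthogonal psi <->
        (forall i : nat, (1 <= i <= 4 * t + 2)%N -> ~~ odd i ->
           nth_row_sum psi i = 0) /\
        (forall i : nat, (1 < i <= 4 * t + 2)%N -> odd i ->
           nth_row_sum psi i = 2 \/ nth_row_sum psi i = -2)].
Proof.
have n_gt1 : (1 < 4 * t + 2)%N by lia.
have oppE i j : (i + j = 4 * t + 2)%N -> i%:R = - j%:R :> 'Z_(4 * t + 2).
  by move=> ij; apply/eqP; rewrite -addr_eq0 -natrD ij pchar_Zp.
have pm1psi g h : pm1 (psi g h) by case: hpsi.
split.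
- move=> i hi; rewrite !nth_row_sumE.
  rewrite (oppE i.-1 (4 * t + 4 - i).-1); last by lia.
  rewrite cocycle_sumN //.
  by case: (pm1psi (4 * t + 4 - i).-1%:R (- (4 * t + 4 - i).-1%:R)) => ->;
    [left | right]; rewrite ?mul1r ?mulN1r.
- rewrite nth_row_sumE (addn2 (2 * t)) /=.
  have mE : (4 * t + 2 = (2 * t).+1 + (2 * t).+1)%N by lia.
  have := cocycle_sumN hpsi (2 * t).+1%:R.
  rewrite -(oppE _ _ (esym mE)) (noncoboundary_half n_gt1) // mulN1r.
  by move/eqP; rewrite -addr_eq0 -mulr2n mulrn_eq0 => /eqP.
have cardZ : #|'Z_(4 * t + 2)| = (4 * t + 2)%N by rewrite card_ord Zp_cast.
pose R (g : 'Z_(4 * t + 2)) : int := \sum_h psi g h.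
(* The pointwise lower bound for [|R g|] at g != 0; parity is that of the representative, opposite
   to that of the row number. *)
pose e (g : 'Z_(4 * t + 2)) : int := if odd g then 0 else 2.
have RE : row_excess (cocycle_mx psi) = \sum_(g | g != 0) `|R g|.
  apply: eq_bigr => g _; congr `|_|.
  by apply: eq_bigr => h _; rewrite mxE.
have le_eR (g : 'Z_(4 * t + 2)) : e g <= `|R g|.
  rewrite /e; case: ifP => [|/negbT g_even]; first by rewrite normr_ge0.
  rewrite /R -[g]natr_Zp -(even_halfK g_even) -addnn natrD.
  exact: cocycle_sum_double_ge2 cardZ.
have sum_e : \sum_(g | g != 0) e g = (4 * t)%N%:Z.
  rewrite -[in RHS](sum_even_lt t) big_mkord -natz natr_sum.
  rewrite -[in RHS](Zp_cast n_gt1).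
  by apply: eq_bigr => g _; rewrite /e; case: ifP.
have rowR i : (0 < i <= 4 * t + 2)%N ->
    exists g : 'Z_(4 * t + 2), g = i.-1 :> nat /\ nth_row_sum psi i = R g.
  move=> hi; exists i.-1%:R; rewrite nth_row_sumE val_Zp_nat // modn_small //.
  by lia.
have Rrow (g : 'Z_(4 * t + 2)) :
    (0 < g.+1 <= 4 * t + 2)%N /\ R g = nth_row_sum psi g.+1.
  rewrite nth_row_sumE /= natr_Zp; split=> //.
  by have := ltn_ord g; rewrite {2}Zp_cast.
split.
- case=> _; rewrite RE -sum_e => /eqP; rewrite -subr_eq0 -sumrB => sum0.
  (* The nonnegative differences [|R g| - e g] sum to 0, so each vanishes. *)
  have eqR g : g != 0 -> `|R g| = e g.
    move=> g0; apply/eqP; rewrite -subr_eq0; apply/eqP.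
    move: sum0; rewrite psumr_eq0; last by move=> h _; rewrite subr_ge0.
    by move=> /allP/(_ g (mem_index_enum g))/implyP/(_ g0)/eqP.
  split=> i hi oddi; have [|g [gE ->]] := rowR i; [by lia| |by lia|];
    by have := eqR g; rewrite /e gE -val_eqE /= gE; case: ifP; lia.
- case=> row_even row_odd; split=> //.
  rewrite RE -sum_e; apply: eq_bigr => g; rewrite -val_eqE /= => g0.
  have [hg ->] := Rrow g; rewrite /e; case: ifP => og.
  + by rewrite row_even //= og.
  + by have [||->|->] := row_odd g.+1 => //=; rewrite ?og //; lia.
Qed.
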